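(* Let $G=(V,E)$ be a connected and loopless multigraph and let $U$ be a (non-empty) clique of $G$. If $S_1$ and $S_2$ form a partition of $V-U$ with $N_G[S_1]\cap N_G[S_2]=\emptyset$, then for any $W\subseteq E-E(G[U])$, $$\tau_G(W)=\frac{\tau_{G[U\cup S_1]}(W_1)\cdot\tau_{G[U\cup S_2]}(W_2)}{|U|^{|U|-2}},$$ where $W_i=W\cap E(G[U\cup S_i])$ for $i=1,2$.
   Context: Graphs are finite multigraphs without loops (parallel edges allowed). $G[X]$ is the subgraph of $G$ induced by the vertex set $X$. A set $U$ of vertices is a clique of $G$ if $G[U]$ is a complete graph; in particular $G[U]$ has no parallel edges. For $X\subseteq V$, $N_G(X)=\bigcup_{v\in X}N_G(v)$, where $N_G(v)$ is the set of neighbours of $v$, and $N_G[X]=X\cup N_G(X)$. For an edge set $W\subseteq E(G)$, $\tau_G(W)$ is the number of spanning trees $T$ of $G$ with $W\subseteq E(T)$ (parallel edges are distinct, so spanning trees are distinguished by their edge sets). *)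

(* Defs.v *)
From HB Require Import structures.
From mathcomp Require Import all_boot all_order all_algebra.

Set Implicit Arguments.
Unset Strict Implicit.
Unset Printing Implicit Defensive.

(* Vertices and edges are drawn from ambient finite types V and E, so that all
   subgraphs of a graph live in the same type and edge sets are compared
   directly. The value of ends outside edges is irrelevant. An edge has exactly
   two endpoints (no loops); several edges may have the same endpoints. *)
Record multigraph (V E : finType) := Multigraph {
  verts : {set V};
  edges : {set E};
  ends : E -> {set V};
  ends_verts : forall e, e \in edges -> ends e \subset verts;
  ends_card2 : forall e, e \in edges -> #|ends e| = 2
}.

Section Multigraph.
Variables V E : finType.
Implicit Types (G : multigraph V E) (X : {set V}) (T W : {set E}).

Definition adj G : rel V :=
  [rel u v | [exists e in edges G, ends G e == [set u; v]]].

Definition neighbours G v : {set V} := [set u | adj G v u].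

Definition open_nbhd G X : {set V} := \bigcup_(v in X) neighbours G v.

Definition closed_nbhd G X : {set V} := X :|: open_nbhd G X.

Section Induced.
Variables (G : multigraph V E) (X : {set V}).

Let iedges := [set e in edges G | ends G e \subset X].

Lemma induced_ends_verts e :
  e \in iedges -> ends G e \subset verts G :&: X.
Proof. by rewrite inE subsetI => /andP[/ends_verts-> ->]. Qed.

Lemma induced_ends_card2 e : e \in iedges -> #|ends G e| = 2.
Proof. by rewrite inE => /andP[/ends_card2]. Qed.

Definition induced : multigraph V E :=
  Multigraph induced_ends_verts induced_ends_card2.

End Induced.

Section Spanning.
Variables (G : multigraph V E) (T : {set E}).

Lemma spanning_ends_verts e :
  e \in edges G :&: T -> ends G e \subset verts G.
Proof. by rewrite inE => /andP[/ends_verts]. Qed.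

Lemma spanning_ends_card2 e : e \in edges G :&: T -> #|ends G e| = 2.
Proof. by rewrite inE => /andP[/ends_card2]. Qed.

Definition spanning_subgraph : multigraph V E :=
  Multigraph spanning_ends_verts spanning_ends_card2.

End Spanning.

Definition connected G : bool :=
  (verts G != set0) &&
  [forall u in verts G, forall v in verts G, connect (adj G) u v].

Definition complete G : bool :=
  [forall u in verts G, forall v in verts G,
     (u != v) ==> (#|[set e in edges G | ends G e == [set u; v]]| == 1)].

Definition clique G X : bool := (X \subset verts G) && complete (induced G X).

(* The sequence (v_0, e_0), ..., (v_(k-1), e_(k-1)) stands for the cycle
   v_0 e_0 v_1 e_1 ... v_(k-1) e_(k-1) v_0. Two parallel edges form a cycle with
   k = 2; k = 1 is excluded since e_0 has two endpoints. *)
Definition is_cycle G (c : seq (V * E)) : bool :=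
  [&& c != [::], uniq (unzip1 c), uniq (unzip2 c) &
      cycle [rel p q | (p.2 \in edges G) && (ends G p.2 == [set p.1; q.1])] c].

(* The bound on the length is no restriction: see acyclicP. *)
Definition acyclic G : bool :=
  [forall k : 'I_#|V|.+1, forall c : k.-tuple (V * E), ~~ is_cycle G c].

Lemma acyclicP G : reflect (forall c, ~~ is_cycle G c) (acyclic G).
Proof.
apply: (iffP forallP) => [acG c | acG k]; last by apply/forallP=> c.
apply/negP=> cyc_c; have /and4P[_ Uc _ _] := cyc_c.
have le_c: size c < #|V|.+1.
  by rewrite ltnS -(size_map fst) -(card_uniqP Uc) max_card.
by have /forallP/(_ (in_tuple c))/negP := acG (Ordinal le_c); apply.
Qed.

Definition tree G : bool := connected G && acyclic G.

Definition spanning_tree G T : bool :=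
  (T \subset edges G) && tree (spanning_subgraph G T).

Definition tau G W : nat := #|[set T | spanning_tree G T & W \subset T]|.

End Multigraph.

(* Main.v *)
Require Import Defs.
From HB Require Import structures.
From mathcomp Require Import all_boot all_order all_algebra.
From mathcomp Require Import ring.

(** Write K for the edges inside the clique U and u for |U|. A spanning tree T
    splits into its part H outside K, a forest, and its part in K, which
    completes H to a spanning tree. The number of completions of a given H
    depends only on how the components C of H meet U, by a formula of Moon
    (Cayley's formula being the case of no edges and U the whole vertex set):

      u ^ 2 * (number of completions of H) = \prod_C (u * |C :&: U|).

    It is [card_completions], proved by induction on the number k of components
    through a double count of the pairs (completion T, edge e of T in K):
    a completion has k - 1 edges in K, while the completions that contain e are
    those of e |: H, and merging the components of x and y multiplies the
    product by 1/u (1/c_x + 1/c_y), where c_z is the number of vertices of U in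
    the component of z. Each x in U lies on u - c_x edges of K that leave its
    component, and \sum_(x in U) 1/c_x counts the components, so the new
    products sum to k - 1 times the old one.

    Hence u ^ 2 * tau is a sum over forests H outside K of the product above,
    [forest_weight] ([tau_clique]). The edges of G outside K are those of
    G[U :|: S1] outside K together with those of G[U :|: S2] outside K. The
    former lie in the closed neighbourhood N of S1 and the latter, being in that
    of S2, avoid N. So the forests H are the unions of a forest H1 of the first
    side and a forest H2 of the second one, which do not touch each other, and
    the components of H are those of H1 in N and those of H2 off N. The weights
    of H1 and H2 have in addition one factor u for every vertex of U that their
    own side leaves isolated, off N for H1 and in N for H2, that is u factors u
    in total ([forest_weight_glue]). Summing over the pairs (H1, H2) gives
    u ^ 2 * tau1 * (u ^ 2 * tau2) = u ^ u * (u ^ 2 * tau), which is the claim. *)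

Import Order.TTheory GRing.Theory Num.Theory.

Set Implicit Arguments.
Unset Strict Implicit.
Unset Printing Implicit Defensive.

(** * Components and forests of edge sets *)

Section EdgeSets.
Variables (V E : finType) (ends : E -> {set V}).
Implicit Types (T A : {set E}) (X Y : {set V}).

Definition link T : rel V :=
  [rel u v | [exists e in T, ends e == [set u; v]]].

Definition component T x : {set V} := [set y | connect (link T) x y].

(** The components that meet X, kept whole: only their representatives are
    restricted to X, so that a product over components can be split along a
    partition of the vertices. *)
Definition components X T : {set {set V}} := component T @: X.

Lemma mem_component T x y : (y \in component T x) = connect (link T) x y.
Proof. by rewrite inE. Qed.

Lemma link_connect_sym T : connect_sym (link T).
Proof.
by apply: sym_connect_sym => u v; apply: eq_existsb => e; rewrite setUC.
Qed.

Lemma component_refl T x : x \in component T x.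
Proof. by rewrite inE connect0. Qed.

Lemma component_sym T x y : (y \in component T x) = (x \in component T y).
Proof. by rewrite !inE link_connect_sym. Qed.

Lemma eq_component T x y : (component T x == component T y) = (y \in component T x).
Proof.
apply/eqP/idP=> [-> | xy]; first exact: component_refl.
apply/setP=> z; rewrite !inE in xy *.
exact: (same_connect (@link_connect_sym T)).
Qed.

Lemma component_step T e x u v :
  e \in T -> ends e = [set u; v] -> u \in component T x -> v \in component T x.
Proof.
rewrite !inE => Te De xu; apply: connect_trans xu (connect1 _).
by apply/existsP; exists e; rewrite Te De /=.
Qed.

(** Induction along a walk: every set that contains x and is closed under the
    edges of T contains the component of x. *)
Lemma component_min T x Y :
    x \in Y ->
    (forall e u v, e \in T -> ends e = [set u; v] -> u \in Y -> v \in Y) ->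
  component T x \subset Y.
Proof.
move=> Yx stepY; apply/subsetP=> y; rewrite inE => /connectP[p].
elim: p x Yx => [|z p IHp] x Yx /= => [_ -> // | /andP[/exists_inP[e Te /eqP De]]].
exact/IHp/(stepY e x).
Qed.

Lemma componentS T A x : T \subset A -> component T x \subset component A x.
Proof.
move=> sTA; apply: component_min => [|e u v Te]; first exact: component_refl.
exact: component_step (subsetP sTA e Te).
Qed.

(** A walk that starts in X never leaves it: at a vertex of X only edges of A
    are available, and these stay in X. *)
Lemma component_local T A X x :
    A \subset T -> x \in X -> (forall e, e \in A -> ends e \subset X) ->
    (forall e, e \in T :\: A -> [disjoint ends e & X]) ->
  component T x = component A x.
Proof.
move=> sAT Xx sAX disX; apply/eqP; rewrite eqEsubset (componentS x sAT) andbT.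
have sCX: component A x \subset X.
  apply: component_min => // e u v Ae De _.
  by rewrite (subsetP (sAX e Ae)) // De set22.
apply: component_min => [|e u v Te De Cu]; first exact: component_refl.
have [Ae | A'e] := boolP (e \in A); first exact: component_step Ae De Cu.
have := disX e; rewrite inE A'e Te => /(_ isT)/pred0P/(_ u) /=.
by rewrite De set21 (subsetP sCX).
Qed.

Lemma component_merge_in T e x y z :
    ends e = [set x; y] -> z \in component T x :|: component T y ->
  component (e |: T) z = component T x :|: component T y.
Proof.
move=> De; have sT: T \subset e |: T by apply: subsetUr.
have Exy: component (e |: T) x = component (e |: T) y.
  apply/eqP; rewrite eq_component.
  by apply: (component_step (setU11 e T) De); apply: component_refl.
have E1: component (e |: T) x = component T x :|: component T y.
  apply/eqP; rewrite eqEsubset subUset {3}Exy !(componentS _ sT) !andbT.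
  apply: component_min => [|f u v]; first by rewrite inE component_refl.
  rewrite in_setU1 => /predU1P[-> | Tf] Df.
    have: v \in [set x; y] by rewrite -De Df set22.
    by rewrite !inE => /pred2P[] -> _; rewrite connect0 ?orbT.
  by rewrite !in_setU => /orP[] /(component_step Tf Df) ->; rewrite ?orbT.
by rewrite -E1 => xz; apply/eqP; rewrite eq_component component_sym.
Qed.

Lemma component_merge_out T e x y z :
    ends e = [set x; y] -> z \notin component T x :|: component T y ->
  component (e |: T) z = component T z.
Proof.
move=> De; rewrite in_setU !(component_sym _ _ z) => xyz.
apply/eqP; rewrite eqEsubset (componentS _ (subsetUr _ _)) andbT.
apply: component_min => [|f u v]; first exact: component_refl.
rewrite in_setU1 => /predU1P[-> | Tf] Df; last exact: component_step Tf Df.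
have: u \in [set x; y] by rewrite -De Df set21.
by rewrite !inE in xyz * => /pred2P[] -> xz; rewrite xz ?orbT in xyz.
Qed.

Lemma components_merge X T e x y :
    ends e = [set x; y] -> x \in X -> y \in X ->
  components X (e |: T) =
    (component T x :|: component T y)
      |: (components X T :\ component T x :\ component T y).
Proof.
move=> De Xx Xy; apply/setP=> C; rewrite in_setU1 !in_setD1.
apply/imsetP/predU1P=> [[z Xz ->] | [-> | /and3P[yC xC /imsetP[z Xz DC]]]].
- have [xyz | xy'z] := boolP (z \in component T x :|: component T y).
    by left; apply: component_merge_in.
  right; rewrite (component_merge_out De) // imset_f //.
  move: xy'z; rewrite !eq_component in_setU !(component_sym _ z).
  by rewrite orbC negb_or andbT.
- by exists x; rewrite // (component_merge_in De) // in_setU component_refl.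
exists z; rewrite // (component_merge_out De) // in_setU negb_or.
by rewrite DC !eq_component in xC yC; rewrite !(component_sym _ _ z) xC.
Qed.

(** The exchange of two components for their union, stated with both sides
    multiplied by the missing terms since op need not be invertible. *)
Lemma big_components_merge R idx (op : Monoid.com_law idx) X T e x y
    (F : {set V} -> R) :
    ends e = [set x; y] -> x \in X -> y \in X -> y \notin component T x ->
  op (F (component T x)) (op (F (component T y))
      (\big[op/idx]_(C in components X (e |: T)) F C)) =
  op (F (component T x :|: component T y))
     (\big[op/idx]_(C in components X T) F C).
Proof.
move=> De Xx Xy xy'; rewrite (components_merge T De Xx Xy) big_setU1 /=; last first.
  apply/negP; rewrite !in_setD1 => /and3P[_ nxy /imsetP[z _ Dz]].
  have: component T x = component T z.
    apply/eqP; rewrite eq_component component_sym -Dz.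
    by rewrite in_setU component_refl.
  by rewrite -Dz => eqC; rewrite -eqC eqxx in nxy.
rewrite [in RHS](big_setD1 (component T x)) ?imset_f //=.
rewrite [in RHS](big_setD1 (component T y)) ?in_setD1 ?imset_f //=; last first.
  by rewrite eq_sym eq_component xy'.
set a := F _; set b := F _; set c := F _; set d := \big[_/_]_(_ in _) _.
by rewrite [LHS]Monoid.mulmA [LHS]Monoid.mulmCA -!Monoid.mulmA.
Qed.

Lemma card_components_merge X T e x y :
    ends e = [set x; y] -> x \in X -> y \in X -> y \notin component T x ->
  #|components X (e |: T)|.+1 = #|components X T|.
Proof.
move=> De Xx Xy xy'; have /= := big_components_merge addn (fun=> 1) De Xx Xy xy'.
by rewrite !sum1_card !add1n => /succn_inj.
Qed.

Lemma big_components_split R idx (op : Monoid.com_law idx) X Y T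
    (F : {set V} -> R) :
    (forall e, e \in T -> ends e \subset Y \/ [disjoint ends e & Y]) ->
  \big[op/idx]_(C in components X T) F C =
  op (\big[op/idx]_(C in components (X :&: Y) T) F C)
     (\big[op/idx]_(C in components (X :\: Y) T) F C).
Proof.
move=> splitT; rewrite -bigU; last first.
  apply/pred0P=> C; apply/andP=> -[/imsetP[x /setIP[_ Yx] ->]].
  case/imsetP=> z /setDP[_ Y'z] eqC; case/negP: Y'z.
  have: z \in component T x by rewrite eqC component_refl.
  apply/subsetP/component_min => // e u v Te De Yu.
  case: (splitT e Te) => [/subsetP-> // | ]; first by rewrite De set22.
  by move/pred0P/(_ u); rewrite /= Yu De set21.
by apply: eq_bigl => C; rewrite -{1}(setID X Y) /components imsetU !inE.
Qed.

(** Every edge is a bridge. Unlike the absence of cycles, this form is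
    compatible with adding and removing edges one at a time. *)
Definition forest T : bool :=
  [forall e in T, forall x, forall y,
     (ends e == [set x; y]) ==> (y \notin component (T :\ e) x)].

Lemma forestP T :
  reflect (forall e x y, e \in T -> ends e = [set x; y] ->
             y \notin component (T :\ e) x)
          (forest T).
Proof.
apply: (iffP forall_inP) => forT e => [x y /forT/forallP/(_ x)/forallP/(_ y) | Te].
  by move=> + /eqP De; rewrite De.
by apply/forallP=> x; apply/forallP=> y; apply/implyP=> /eqP; apply: forT.
Qed.

Lemma forestS T A : T \subset A -> forest A -> forest T.
Proof.
move=> sTA /forestP forA; apply/forestP=> e x y Te De.
apply: contra (forA e x y (subsetP sTA e Te) De).
exact/subsetP/componentS/setSD.
Qed.

(** For an old edge f, if f became redundant then its ends, separated in T :\ f,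
    would be joined through e, so f would join the component of x to that of
    y, and x, y would be connected in T. *)
Lemma forestU1 T e x y :
    ends e = [set x; y] -> y \notin component T x -> forest T ->
  forest (e |: T).
Proof.
move=> De xy' /forestP forT; have T'e: e \notin T.
  apply: contra xy' => Te; exact: component_step Te De (component_refl _ _).
apply/forestP=> f u v; rewrite in_setU1 => /predU1P[-> | Tf] Df.
  rewrite setU1K //; apply: contra xy' => uv.
  have uvT z: z \in ends e -> z \in component T u.
    by rewrite Df !inE => /pred2P[] ->; rewrite ?connect0 // -mem_component.
  rewrite -eq_component; apply/eqP/esym.
  have /eqP<-: component T u == component T y by rewrite eq_component uvT // De set22.
  by apply/eqP; rewrite eq_component uvT // De set21.
have nfe: f != e by apply: contraNneq T'e => <-.
have ->: (e |: T) :\ f = e |: (T :\ f).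
  by apply/setP=> g; rewrite !inE; case: eqP => //= ->; rewrite (negPf nfe).
have uv' := forT f u v Tf Df.
have sT z w : component (T :\ f) z == component (T :\ f) w ->
    component T z == component T w.
  by rewrite !eq_component; apply/subsetP/componentS/subsetDl.
have [| /(component_merge_out De) -> //] :=
  boolP (u \in component (T :\ f) x :|: component (T :\ f) y).
move=> /[dup] xyu /(component_merge_in De) ->.
have Tuv: v \in component T u by apply: component_step Tf Df (component_refl _ _).
apply: contraNN xy' => xyv; rewrite -!eq_component in uv' Tuv *.
rewrite !in_setU -!eq_component in xyu xyv.
case/orP: xyu => Hu; case/orP: xyv => Hv.
- by case/eqP: uv'; rewrite -(eqP Hu) (eqP Hv).
- by rewrite (eqP (sT _ _ Hu)) (eqP (sT _ _ Hv)).
- by rewrite (eqP (sT _ _ Hu)) (eqP (sT _ _ Hv)) eq_sym.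
by case/eqP: uv'; rewrite -(eqP Hu) (eqP Hv).
Qed.

(** Each edge of a forest joins two components of the rest, so removing it
    raises the number of components by one, up to |X| singletons. *)
Lemma card_components_forest X T :
    (forall e, e \in T -> ends e \subset X /\ #|ends e| = 2) -> forest T ->
  #|components X T| + #|T| = #|X|.
Proof.
elim: {T}_.+1 {-2}T (ltnSn #|T|) => // n IHn T leTn endT forT.
have [-> | [e Te]] := set_0Vmem T.
  rewrite cards0 addn0 -(card_imset X set1_inj); congr #|pred_of_set _|.
  apply: eq_imset => x; apply/eqP; rewrite eqEsubset sub1set component_refl andbT.
  by apply: component_min => [|e u v]; [apply: set11 | rewrite in_set0].
have [sXe /eqP/cards2P[x [y [_ De]]]] := endT e Te.
have Xx: x \in X by rewrite (subsetP sXe) // De set21.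
have Xy: y \in X by rewrite (subsetP sXe) // De set22.
have xy' := forestP _ forT e x y Te De.
have := card_components_merge De Xx Xy xy'.
rewrite setD1K // => DT; rewrite (cardsD1 e T) Te addnA addn1 DT IHn //.
- by rewrite (cardsD1 e T) Te in leTn.
- by move=> f /setD1P[_]; apply: endT.
exact: forestS (subsetDl _ _) forT.
Qed.

End EdgeSets.

(** * Spanning trees are connected forests *)

Section SpanningTrees.
Variables (V E : finType) (G : multigraph V E).
Implicit Types (T A : {set E}).

Lemma connected_spanningE T :
    T \subset edges G ->
  connected (spanning_subgraph G T) = (#|components (ends G) (verts G) T| == 1).
Proof.
move=> sTG; have eq_adj: adj (spanning_subgraph G T) =2 link (ends G) T.
  by move=> u v; rewrite /adj /link /= (setIidPr sTG).
apply/andP/cards1P=> [[/set0Pn[x Gx] conT] | [C DC]].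
  exists (component (ends G) T x); apply/setP=> C; rewrite inE.
  apply/imsetP/eqP=> [[y Gy ->] | ->]; last by exists x.
  apply/eqP; rewrite eq_component mem_component -(eq_connect eq_adj).
  by have /forall_inP/(_ y Gy)/forall_inP/(_ x Gx) := conT.
split.
  apply/negP=> /eqP /= G0; move/setP/(_ C): DC.
  by rewrite G0 /components imset0 !inE eqxx.
have compC x : x \in verts G -> component (ends G) T x = C.
  by move=> Gx; apply/set1P; rewrite -DC imset_f.
apply/forall_inP=> u Gu; apply/forall_inP=> v Gv.
by rewrite (eq_connect eq_adj) -mem_component -eq_component !compC.
Qed.

(** Follows the encoding of cycles: (u, e) precedes (v, f) when e joins u to v. *)
Let step A : rel (V * E) :=
  [rel p q | (p.2 \in A) && (ends G p.2 == [set p.1; q.1])].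

(** Chooses an edge for every step of a path with distinct vertices. These edges
    are distinct since the first one has an end at x, which the later ones
    avoid. The last clause lets an edge f into x precede the path and a pair
    with edge e follow it, which is what closing up to a cycle needs. *)
Lemma path_edge_list A T e x p :
    path (link (ends G) A) x p -> uniq (x :: p) -> A \subset T ->
  exists c : seq (V * E),
    [/\ unzip1 c = belast x p, uniq (unzip2 c), {subset unzip2 c <= A},
        forall f u, f \in unzip2 c -> u \in ends G f -> u \in x :: p
      & forall w f, f \in T -> ends G f = [set w; x] ->
          path (step T) (w, f) (rcons c (last x p, e))].
Proof.
move=> + + sAT; elim: p x => [|z p IHp] x /=.
  by move=> _ _; exists [::]; split=> // w f Tf Df; rewrite /step /= Tf Df eqxx.
case/andP=> /exists_inP[g Ag /eqP Dg] Pp /andP[p'x Up].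
have [c [Dc Uc sCA endC Pc]] := IHp z Pp Up.
exists ((x, g) :: c); split=> /=; first by rewrite Dc.
- rewrite Uc andbT; apply: contra p'x => /endC; apply.
  by rewrite Dg set21.
- by move=> f /predU1P[-> | /sCA].
- move=> f u /predU1P[-> | /endC zu /zu]; last first.
    by rewrite [in X in _ -> X]in_cons orbC => ->.
  by rewrite Dg => /set2P[] ->; rewrite !inE eqxx ?orbT.
move=> w f Tf Df; rewrite {1}/step /= Tf Df eqxx; apply: Pc => //.
exact: (subsetP sAT).
Qed.

Lemma step_path_connect T e p s :
    path (step T) p s -> e \notin unzip2 (belast p s) ->
  (last p s).1 \in component (ends G) (T :\ e) p.1.
Proof.
elim: s p => [|q s IHs] p /= => [_ _ | /andP[/andP[Tp /eqP Dp] Ps]].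
  exact: component_refl.
rewrite in_cons negb_or => /andP[nep /(IHs q Ps)].
rewrite -!eq_component => /eqP <-; rewrite eq_component.
apply: (component_step _ Dp (component_refl _ _ _)).
by rewrite in_setD1 eq_sym nep.
Qed.

(** If e is not a bridge, a path joining its ends without e closes to a cycle;
    conversely the rest of a cycle joins the ends of its first edge. *)
Lemma acyclic_spanningE T :
  T \subset edges G -> acyclic (spanning_subgraph G T) = forest (ends G) T.
Proof.
move=> sTG; apply/acyclicP/forestP=> [acT e x y Te De | forT c].
  apply/negP; rewrite mem_component => /connectP[p0 /shortenP[p Pp Up _] Dy].
  have [c [Dc Uc sC _ Pc]] := path_edge_list e Pp Up (subsetDl T [set e]).
  have Ucy: uniq (y :: unzip1 c).
    by rewrite Dc Dy /= -rcons_uniq -lastI.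
  have /negP[] := acT ((y, e) :: c); apply/and4P; split=> //.
    rewrite /= Uc andbT; apply/negP=> /sC.
    by rewrite setD11.
  by rewrite /= (setIidPr sTG) [in rcons _ _]Dy; apply: Pc; rewrite // De setUC.
apply/negP=> /and4P[]; case: c => // -[v0 e0] c _ _ /=.
rewrite (setIidPr sTG); case: c => [|[v1 e1] c] /andP[ce0 _] /=.
  case/andP=> /andP[Te0]; have := ends_card2 (subsetP sTG _ Te0).
  by move=> + /eqP De; rewrite De setUid cards1.
case/andP=> /andP[Te0 /eqP De0] Pc; case/negP: (forT _ _ _ Te0 De0).
rewrite component_sym.
have := @step_path_connect T e0 (v1, e1) (rcons c (v0, e0)) Pc.
by rewrite belast_rcons last_rcons; apply.
Qed.

Lemma spanning_treeE T :
  spanning_tree G T =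
  [&& T \subset edges G, forest (ends G) T
    & #|components (ends G) (verts G) T| == 1].
Proof.
rewrite /spanning_tree /tree; case: (boolP (T \subset _)) => //= sTG.
by rewrite connected_spanningE // acyclic_spanningE // andbC.
Qed.

End SpanningTrees.

(** * Completing a forest inside a clique *)

Local Open Scope ring_scope.

(** The product of Moon's formula. When a component misses U, it vanishes, and
    indeed no edges inside U can then connect the graph. *)
Definition forest_weight (V E : finType) (ends : E -> {set V}) (U X : {set V})
    (H : {set E}) : rat :=
  \prod_(C in components ends X H) (#|U| * #|C :&: U|)%:R.

Section CliqueCompletions.
Variables (V E : finType) (G : multigraph V E) (U : {set V}).
Hypotheses (U_nonempty : U != set0) (U_clique : clique G U).
Implicit Types (H T : {set E}).

Let K := edges (induced G U).
Let X := verts G.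
Let comp H := component (ends G) H.
Let comps H := components (ends G) X H.
Let weight := forest_weight (ends G) U X.
Let size_in H x : rat := #|comp H x :&: U|%:R.
Let u : rat := #|U|%:R.

Let sUX : U \subset X.
Proof. by case/andP: U_clique. Qed.

Let u_neq0 : u != 0.
Proof. by rewrite pnatr_eq0 cards_eq0. Qed.

Let size_in_neq0 H x : x \in U -> size_in H x != 0.
Proof.
move=> Ux; rewrite pnatr_eq0 cards_eq0; apply/set0Pn; exists x.
by rewrite inE component_refl.
Qed.

Let K_ends e : e \in K -> exists x y,
  [/\ x \in U, y \in U, x != y & ends G e = [set x; y]].
Proof.
rewrite inE => /andP[Ge sUe]; have /eqP/cards2P[x [y [xy De]]] := ends_card2 Ge.
by exists x, y; split; rewrite // (subsetP sUe) // De !inE eqxx ?orbT.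
Qed.

Lemma clique_edge x y :
    x \in U -> y \in U -> x != y ->
  exists e, [set e in K | ends G e == [set x; y]] = [set e].
Proof.
move=> Ux Uy xy; apply/cards1P; have /andP[_ /forall_inP cliU] := U_clique.
have UX z : z \in U -> z \in verts (induced G U).
  by move=> Uz; rewrite inE Uz (subsetP sUX).
by have /forall_inP/(_ y (UX y Uy))/implyP/(_ xy) := cliU x (UX x Ux).
Qed.

(** A clique has no parallel edges. *)
Lemma ends_clique_inj : {in K &, injective (ends G)}.
Proof.
move=> e f Ke Kf Def; have [x [y [Ux Uy xy De]]] := K_ends Ke.
have [g Dg] := clique_edge Ux Uy xy.
have: e \in [set g] by rewrite -Dg inE Ke De /=.
have: f \in [set g] by rewrite -Dg inE Kf -Def De /=.
by move=> /set1P-> /set1P->.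
Qed.

(** In a clique these edges correspond, through their other end, to the vertices
    of U outside the component of x. *)
Lemma card_leaving_edges H x :
    x \in U ->
  (#|[set e in K | (x \in ends G e) && ~~ (ends G e \subset comp H x)]|
    + #|comp H x :&: U| = #|U|)%N.
Proof.
move=> Ux; set S := [set e in K | _].
have ->: #|S| = #|U :\: comp H x|; last by rewrite setIC addnC cardsID.
rewrite -(card_in_imset (f := ends G)); last first.
  by move=> e f /setIdP[Ke _] /setIdP[Kf _]; apply: ends_clique_inj.
have nx y : y \in U :\: comp H x -> x != y.
  by case/setDP=> _; apply: contraNneq => <-; apply: component_refl.
rewrite -[RHS](card_in_imset (f := fun y => [set x; y])); last first.
  move=> y z /nx xy /nx xz /setP/(_ y).
  by rewrite !inE eqxx orbT eq_sym (negPf xy) => /esym/eqP.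
apply: eq_card => A; apply/imsetP/imsetP=> [[e] | [y]].
  rewrite inE => /and3P[/K_ends[a [b [Ua Ub ab De]]] ex exC] ->.
  have [y Uy Dey]: exists2 y, y \in U & ends G e = [set x; y].
    move: ex; rewrite De => /set2P[] ->; first by exists b.
    by exists a; rewrite // setUC.
  exists y => //; rewrite inE Uy andbT; apply: contra exC => Cy.
  by rewrite Dey subUset !sub1set component_refl.
move=> UCy ->; have /setDP[Uy C'y] := UCy.
have [e De] := clique_edge Ux Uy (nx y UCy).
have: e \in [set e] by rewrite inE.
rewrite -De inE => /andP[Ke /eqP Dee]; exists e => //.
by rewrite inE Ke Dee set21 subUset !sub1set (negPf C'y) andbF.
Qed.

(** Merging components that meet U in a and b vertices replaces the factors
    (u a)(u b) with u (a + b), and (a + b) / (u a b) = (1/a + 1/b) / u. *)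
Lemma weight_merge H e x y :
    x \in U -> y \in U -> ends G e = [set x; y] -> y \notin comp H x ->
  weight (e |: H) = weight H / u / size_in H x + weight H / u / size_in H y.
Proof.
move=> Ux Uy De xy'.
have /= := big_components_merge _ (fun C => (#|U| * #|C :&: U|)%:R : rat)
    De (subsetP sUX x Ux) (subsetP sUX y Uy) xy'.
move/(_ 1 *%R); rewrite -/(forest_weight _ _ _ _) -/(forest_weight _ _ _ _).
have ->: #|(comp H x :|: comp H y) :&: U|
    = (#|comp H x :&: U| + #|comp H y :&: U|)%N.
  rewrite setIUl cardsU.
  suff ->: (comp H x :&: U) :&: (comp H y :&: U) = set0.
    by rewrite cards0 subn0.
  apply/setP=> z; rewrite !inE -/(comp _ _); apply: contraNF xy'.
  case/andP=> /andP[xz _] /andP[yz _]; rewrite /comp -eq_component.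
  rewrite -!mem_component -!eq_component in xz yz.
  by rewrite (eqP xz) (eqP yz).
rewrite !natrM natrD -/u -/(size_in H x) -/(size_in H y) -/weight => mergeE.
have nx := size_in_neq0 H Ux; have ny := size_in_neq0 H Uy.
have nz: u * size_in H x * (u * size_in H y) != 0 by rewrite !mulf_neq0.
apply: (mulfI nz); rewrite -[LHS]mulrA mergeE.
have sum_inv (F : fieldType) (v w a b : F) : v != 0 -> a != 0 -> b != 0 ->
    v * (a + b) * w = v * a * (v * b) * (w / v / a + w / v / b).
  by move=> nv na nb; field; rewrite nv na nb.
exact: sum_inv.
Qed.

(** The sum of 1/c_x is the number of components that meet U, since the c
    vertices of U in a component contribute 1/c each. If some component misses
    U, both sides vanish with the weight. *)
Lemma sum_inv_size_in H :
  weight H * \sum_(x in U) (size_in H x)^-1 = weight H * #|comps H|%:R.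
Proof.
have [-> | W0] := eqVneq (weight H) 0; first by rewrite !mul0r.
congr (_ * _); rewrite (partition_big (comp H) [in comps H]) /=; last first.
  by move=> x Ux; apply/imset_f/(subsetP sUX).
rewrite -sum1_card natr_sum; apply: eq_bigr => C compC.
have nC: #|C :&: U|%:R != 0 :> rat.
  move: W0; rewrite /weight /forest_weight (bigD1 C) //= natrM !mulf_eq0 !negb_or.
  by case/andP=> /andP[].
rewrite (eq_bigr (fun=> (#|C :&: U|%:R)^-1)) => [|x /andP[_ /eqP <-]//].
rewrite (eq_bigl [in C :&: U]) ?sumr_const; last first.
  move=> x; rewrite !inE andbC; congr (_ && _).
  have [z _ ->] := imsetP compC.
  by rewrite /comp eq_component component_sym.
by rewrite -[LHS]mulr_natl mulfV.
Qed.

(** The inner sum is the weight of e |: H if e joins two components, by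
    [weight_merge], and is empty otherwise. Exchanging the sums, x occurs for
    u - c_x edges, and \sum_x (u - c_x) / (u c_x) is the number of components
    minus one. *)
Lemma sum_weight_merge H :
  \sum_(e in K) \sum_(x in ends G e | ~~ (ends G e \subset comp H x))
     weight H / u / size_in H x = weight H * (#|comps H|%:R - 1).
Proof.
have subf_div (F : fieldType) (v w a : F) : v != 0 -> a != 0 ->
    (v - a) * (w / v / a) = w * a^-1 - w / v.
  by move=> nv na; field; rewrite nv na.
rewrite (exchange_big_dep (mem U)) => [|e x Ke /andP[ex _]] /=; last first.
  by move: Ke; rewrite inE => /andP[_ /subsetP]; apply.
under eq_bigr => x Ux.
  set A := [set e in K | (x \in ends G e) && ~~ (ends G e \subset comp H x)].
  rewrite (eq_bigl [in A]) => [|e]; last by rewrite /A inE.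
  have cardA : #|A|%:R = u - size_in H x.
    by rewrite /u -(card_leaving_edges H Ux) natrD addrK.
  rewrite sumr_const -mulr_natl cardA (subf_div _ _ _ _ u_neq0 (size_in_neq0 H Ux)).
  over.
rewrite sumrB -mulr_sumr sum_inv_size_in sumr_const -[X in _ - X]mulr_natr -/u.
by rewrite divfK // mulrBr mulr1.
Qed.

Definition completions H :=
  [set T | [&& spanning_tree G T, H \subset T & T :\: H \subset K]].

Let ends_in_X T :
    T \subset edges G ->
  forall e, e \in T -> ends G e \subset X /\ #|ends G e| = 2.
Proof. by move=> /subsetP sTG e /sTG Ge; rewrite ends_verts ?ends_card2. Qed.

Lemma card_added_edges H T :
  H \subset edges G -> T \in completions H -> #|T :\: H|.+1 = #|comps H|.
Proof.
move=> sHG; rewrite inE => /and3P[]; rewrite spanning_treeE.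
case/and3P=> sTG forT /eqP comT sHT _.
have := card_components_forest (ends_in_X sTG) forT.
rewrite -(card_components_forest (ends_in_X sHG) (forestS sHT forT)) comT.
rewrite -(cardsID H T) (setIidPr sHT) addnCA addnC -/(comps H) => /addIn.
by rewrite add1n.
Qed.

(** Moon's formula: the number of spanning trees of a complete graph containing
    a given forest, here for a forest that may also use vertices outside the
    clique. *)
Lemma card_completions H :
    H \subset edges G -> forest (ends G) H ->
  u ^+ 2 * #|completions H|%:R = weight H.
Proof.
have [m] := ubnP #|comps H|; elim: m H => // m IHm H; rewrite ltnS => leHm sHG forH.
have [comp1 | n1] := eqVneq #|comps H| 1%N.
  have -> : completions H = [set H].
    apply/setP=> T; rewrite in_set1; apply/idP/eqP=> [cT | ->]; last first.
      by rewrite inE spanning_treeE sHG forH subxx setDv sub0set comp1 /=.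
    have := card_added_edges sHG cT; rewrite comp1 => -[] /eqP.
    rewrite cards_eq0 setD_eq0 => sTH; apply/eqP.
    by rewrite eqEsubset sTH; move: cT; rewrite inE => /and3P[].
  have /eqP/cards1P[C DC] := comp1.
  rewrite cards1 mulr1 /weight /forest_weight -/(comps H) DC big_set1.
  suff /setIidPr->: U \subset C by rewrite natrM.
  apply/subsetP=> x Ux; have /set1P <-: comp H x \in [set C].
    by rewrite -DC imset_f // (subsetP sUX).
  exact: component_refl.
have k_neq1: #|comps H|%:R - 1 != 0 :> rat by rewrite subr_eq0 (eqr_nat _ _ 1).
apply: (mulIf k_neq1); rewrite -sum_weight_merge -mulrA.
(* Double count of the pairs (T, e) with T a completion and e added to H. *)
have -> : #|completions H|%:R * (#|comps H|%:R - 1) =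
    \sum_(e in K) #|[set T in completions H | e \in T :\: H]|%:R :> rat.
  have ->: #|completions H|%:R * (#|comps H|%:R - 1)
      = (\sum_(T in completions H) \sum_(e in T :\: H) 1)%:R :> rat.
    rewrite mulr_natl -sumr_const natr_sum; apply: eq_bigr => T cT.
    by rewrite sum1_card -(card_added_edges sHG cT) -natr1 addrK.
  rewrite (exchange_big_dep (mem K)) /= => [|T e]; last first.
    by rewrite inE => /and3P[_ _ /subsetP]; apply.
  rewrite natr_sum; apply: eq_bigr => e _; congr _%:R.
  by rewrite -sum1_card; apply: eq_bigl => T; rewrite [in RHS]inE.
rewrite mulr_sumr; apply: eq_bigr => e Ke.
have [x [y [Ux Uy xy De]]] := K_ends Ke.
(* An edge inside a component of H lies in no completion. *)
have [xyH | xyH] := boolP (y \in comp H x).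
  rewrite big1 => [|z /andP[ez /negP[]]]; last first.
    move: ez; rewrite De subUset !sub1set.
    by move=> /set2P[] ->; rewrite component_refl ?andbT // component_sym.
  suff ->: [set T in completions H | e \in T :\: H] = set0 by rewrite cards0 mulr0.
  apply/setP=> T; rewrite in_set0; apply/setIdP=> -[].
  rewrite inE spanning_treeE => /and3P[/and3P[_ /forestP forT _] sHT _].
  case/setDP=> Te H'e; case/negP: (forT e x y Te De).
  by apply: subsetP xyH; rewrite componentS // subsetD1 sHT.
have H'e: e \notin H.
  by apply: contra xyH => He; apply: component_step He De (component_refl _ _ _).
have Ge: e \in edges G by move: Ke; rewrite inE => /andP[].
have ->: [set T in completions H | e \in T :\: H] = completions (e |: H).
  apply/setP=> T; rewrite inE [T \in completions H]inE [RHS]inE in_setD.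
  rewrite subUset sub1set H'e; case: (spanning_tree G T) => //.
  case: (H \subset T) (e \in T) => -[] //=; rewrite ?andbT ?andbF //.
  apply/idP/idP; first by apply: subset_trans; rewrite setDS ?subsetUr.
  move=> /subsetP sTK; apply/subsetP=> f /setDP[Tf H'f].
  have [-> // | nfe] := eqVneq f e.
  by apply: sTK; rewrite !inE negb_or nfe H'f.
rewrite IHm; last 3 first.
- apply: leq_trans leHm.
  by rewrite -(card_components_merge De (subsetP sUX x Ux) (subsetP sUX y Uy) xyH).
- by rewrite subUset sub1set Ge.
- exact: forestU1 De xyH forH.
rewrite (weight_merge Ux Uy De xyH) (eq_bigl [in [set x; y]]) => [|z].
  by rewrite big_setU1 ?inE // big_set1.
rewrite -De; apply: andb_idr; rewrite De subUset !sub1set => /set2P[] ->.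
  by rewrite (negPf xyH) andbF.
by rewrite component_sym (negPf xyH).
Qed.

(** Spanning trees are grouped by their part outside the clique. As W avoids
    the clique edges, only this part matters for containing W. *)
Lemma tau_clique (W : {set E}) :
    W \subset edges G :\: K ->
  u ^+ 2 * (tau G W)%:R =
    \sum_(H : {set E} | [&& H \subset edges G :\: K, forest (ends G) H & W \subset H])
       weight H.
Proof.
move=> sW; rewrite /tau -sum1_card natr_sum.
rewrite (partition_big (fun T => T :\: K)
  (fun H => [&& H \subset edges G :\: K, forest (ends G) H & W \subset H])) /=.
  rewrite mulr_sumr; apply: eq_bigr => H /and3P[sHGK forH sWH].
  have [sHG disHK] : H \subset edges G /\ [disjoint H & K].
    by move: sHGK; rewrite subsetD => /andP[].
  rewrite -(card_completions sHG forH) -natr_sum -sum1_card; congr (_ * _%:R).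
  apply: eq_bigl => T; rewrite [RHS]inE.
  apply/andP/and3P=> [[/setIdP[stT _] /eqP <-] | [stT sHT]].
    by split; rewrite // ?subsetDl // setDDr setDv set0U subsetIr.
  rewrite subDset => sTHK; split; first by rewrite inE stT (subset_trans sWH).
  by rewrite eqEsubset subDset setUC sTHK subsetD sHT disHK.
move=> T; rewrite inE => /andP[]; rewrite spanning_treeE => /and3P[sTG forT _] sWT.
rewrite setSD // (forestS (subsetDl _ _) forT) subsetD sWT.
by move: sW; rewrite subsetD => /andP[].
Qed.

End CliqueCompletions.

(** * Gluing forests with separate supports *)

Section Glue.
Variables (V E : finType) (ends : E -> {set V}).
Implicit Types (A B H : {set E}) (X Y U : {set V}).

(** Whether an edge is a bridge is decided within X, or within its complement. *)
Lemma forestU_disjoint A B X :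
    (forall e, e \in A -> ends e \subset X) ->
    (forall e, e \in B -> [disjoint ends e & X]) ->
    forest ends A -> forest ends B ->
  forest ends (A :|: B).
Proof.
have half A' B' X' e x y :
    (forall e, e \in A' -> ends e \subset X') ->
    (forall e, e \in B' -> [disjoint ends e & X']) ->
    forest ends A' -> e \in A' -> ends e = [set x; y] ->
  y \notin component ends ((A' :|: B') :\ e) x.
  move=> sAX disB /forestP forA Ae De.
  rewrite (@component_local _ _ _ _ (A' :\ e) X') ?setSD ?subsetUl //.
  - exact: forA.
  - by rewrite (subsetP (sAX e Ae)) // De set21.
  - by move=> f /setD1P[_]; apply: sAX.
  move=> f /setDP[/setD1P[fe]]; rewrite in_setU in_setD1 fe => /orP[-> //|Bf _].
  exact: disB.
move=> sAX disB forA forB; apply/forestP=> e x y /setUP[Ae | Be] De.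
  exact: half sAX disB forA Ae De.
rewrite setUC; apply: (half B A (~: X)) => // f.
  by move/disB; rewrite disjoints_subset.
by move/sAX; rewrite disjoints_subset setCK.
Qed.

Lemma forest_weight_split U X Y H :
    (forall e, e \in H -> ends e \subset Y \/ [disjoint ends e & Y]) ->
  forest_weight ends U X H =
    forest_weight ends U (X :&: Y) H * forest_weight ends U (X :\: Y) H.
Proof. exact: big_components_split. Qed.

Lemma forest_weight_local U X Y A B :
    X \subset Y -> (forall e, e \in A -> ends e \subset Y) ->
    (forall e, e \in B -> [disjoint ends e & Y]) ->
  forest_weight ends U X (A :|: B) = forest_weight ends U X A.
Proof.
move=> sXY sAY disB; rewrite /forest_weight.
suff ->: components ends X (A :|: B) = components ends X A by [].
apply: eq_in_imset => x Xx.
apply: (component_local (subsetUl A B) (subsetP sXY x Xx) sAY) => e.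
by rewrite in_setD in_setU => /andP[/negPf->]; apply: disB.
Qed.

Lemma forest_weight_isolated U X H :
    X \subset U -> (forall e, e \in H -> [disjoint ends e & X]) ->
  forest_weight ends U X H = #|U|%:R ^+ #|X|.
Proof.
move=> sXU disH; have comp1 x : x \in X -> component ends H x = [set x].
  move=> Xx; apply/eqP; rewrite eqEsubset sub1set component_refl andbT.
  apply: component_min => [|e u v He De /set1P Du]; first exact: set11.
  by have := disH e He; move/pred0P/(_ u); rewrite /= De set21 Du Xx.
rewrite /forest_weight /components (eq_in_imset comp1) big_imset /=; last first.
  by move=> x y _ _ /set1_inj.
rewrite -prodr_const; apply: eq_bigr => x Xx.
have /setIidPl-> : [set x] \subset U by rewrite sub1set (subsetP sXU).
by rewrite cards1 muln1.
Qed.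

(** The components of H1 :|: H2 are those of H1 in Y and those of H2 off Y. Both
    factors on the left have in addition singleton components, each of weight
    |U|: the vertices of U off Y for H1, and those in Y for H2. *)
Lemma forest_weight_glue U (S1 S2 Y : {set V}) H1 H2 :
    S1 \subset Y -> [disjoint S2 & Y] ->
    (forall e, e \in H1 -> ends e \subset Y) ->
    (forall e, e \in H2 -> [disjoint ends e & Y]) ->
  forest_weight ends U (U :|: S1) H1 * forest_weight ends U (U :|: S2) H2 =
  #|U|%:R ^+ #|U| * forest_weight ends U (U :|: S1 :|: S2) (H1 :|: H2).
Proof.
move=> sS1Y disS2 sH1 disH2.
have S1Y x : x \in S1 -> x \in Y by apply/subsetP.
have S2Y x : x \in S2 -> x \notin Y by move=> S2x; rewrite (disjointFr disS2 S2x).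
rewrite (@forest_weight_split _ _ Y) => [|e /sH1]; last by left.
rewrite [X in _ * X](@forest_weight_split _ _ Y) => [|e /disH2]; last by right.
rewrite [X in _ = _ * X](@forest_weight_split _ _ Y) => [|e]; last first.
  by case/setUP=> [/sH1|/disH2]; [left | right].
have ->: (U :|: S1) :\: Y = U :\: Y.
  apply/setP=> x; rewrite !inE; case: (boolP (x \in Y)) => //= Y'x.
  by rewrite (contraNF (S1Y x) Y'x) orbF.
have ->: (U :|: S2) :&: Y = U :&: Y.
  apply/setP=> x; rewrite !inE; case: (boolP (x \in S2)) => [/S2Y/negPf-> | _].
    by rewrite !andbF.
  by rewrite orbF.
have ->: (U :|: S1 :|: S2) :&: Y = (U :|: S1) :&: Y.
  apply/setP=> x; rewrite !inE; case: (boolP (x \in S2)) => [/S2Y/negPf-> | _].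
    by rewrite !andbF.
  by rewrite orbF.
have ->: (U :|: S1 :|: S2) :\: Y = (U :|: S2) :\: Y.
  apply/setP=> x; rewrite !inE; case: (boolP (x \in Y)) => //= Y'x.
  by rewrite (contraNF (S1Y x) Y'x) orbF.
rewrite (@forest_weight_isolated _ (U :\: Y)) ?subsetDl => [|//|e /sH1 sY]; last first.
  by rewrite disjoint_sym disjoints_subset setDE subIset // setCS sY orbT.
rewrite (@forest_weight_isolated _ (U :&: Y)) ?subsetIl => [|//|e /disH2]; last first.
  by apply: disjointWr; apply: subsetIr.
rewrite (forest_weight_local U (subsetIr (U :|: S1) Y)) //.
rewrite [H1 :|: H2]setUC.
rewrite (@forest_weight_local _ _ (~: Y)) ?setDE ?subsetIr //; last 2 first.
- by move=> e /disH2; rewrite disjoints_subset.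
- by move=> e /sH1; rewrite disjoints_subset setCK.
rewrite -[X in _ = _ ^+ X * _](cardsID Y U) exprD !setDE.
move: (forest_weight _ _ _ _) (forest_weight _ _ _ _) (_ ^+ _) (_ ^+ _) => a b c d.
ring.
Qed.

End Glue.

(** * Induced subgraphs *)

Section Induced.
Variables (V E : finType) (G : multigraph V E).
Implicit Types (U X Y S : {set V}).

Lemma edges_induced_induced U Y :
  U \subset Y -> edges (induced (induced G Y) U) = edges (induced G U).
Proof.
move=> sUY; apply/setP=> e; rewrite !inE -andbA; case: (e \in edges G) => //=.
by rewrite andb_idl // => sU; apply: subset_trans sU sUY.
Qed.

Lemma clique_induced U Y :
  U \subset Y -> clique G U -> clique (induced G Y) U.
Proof.
move=> sUY /andP[sUG cliU]; rewrite /clique /= subsetI sUG sUY.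
rewrite /complete edges_induced_induced //= -setIA (setIidPr sUY).
exact: cliU.
Qed.

Lemma edge_closed_nbhd S e x :
  e \in edges G -> x \in ends G e -> x \in S -> ends G e \subset closed_nbhd G S.
Proof.
move=> Ge ex Sx; apply/subsetP=> y ey; rewrite in_setU.
have [-> | nyx] := eqVneq y x; first by rewrite Sx.
apply/orP; right; apply/bigcupP; exists x; rewrite // inE.
apply/exists_inP; exists e => //; rewrite eq_sym eqEcard cards2 eq_sym nyx.
by rewrite subUset !sub1set ex ey ends_card2.
Qed.

Lemma outer_edge_nbhd U S e :
    e \in edges (induced G (U :|: S)) :\: edges (induced G U) ->
  ends G e \subset closed_nbhd G S.
Proof.
case/setDP; rewrite !inE => /andP[Ge sUS]; rewrite Ge => /subsetPn[x ex U'x].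
apply: (edge_closed_nbhd Ge ex).
by have := subsetP sUS x ex; rewrite in_setU (negPf U'x).
Qed.

(** An edge with an end in S lies in the closed neighbourhood of S, which S'
    cannot meet. *)
Lemma edge_induced_side U S S' e x :
    verts G = U :|: S :|: S' -> [disjoint closed_nbhd G S & closed_nbhd G S'] ->
    e \in edges G -> x \in ends G e -> x \in S ->
  e \in edges (induced G (U :|: S)).
Proof.
move=> DV disN Ge ex Sx; rewrite inE Ge; apply/subsetP=> y ey.
have := subsetP (ends_verts Ge) y ey; rewrite DV in_setU => /orP[// | S'y].
have Ny := subsetP (edge_closed_nbhd Ge ex Sx) y ey.
by have := disjointFr disN Ny; rewrite {1}/closed_nbhd in_setU S'y.
Qed.

End Induced.

(** * The two sides of a clique *)

Theorem theorem6p1 (V E : finType) (G : multigraph V E)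
    (U S1 S2 : {set V}) (W : {set E})
    (G_connected : connected G)
    (U_nonempty : U != set0)
    (U_clique : clique G U)
    (S12_cover : S1 :|: S2 = verts G :\: U)
    (S12_disjoint : [disjoint S1 & S2])
    (S12_nbhd : closed_nbhd G S1 :&: closed_nbhd G S2 = set0)
    (W_sub : W \subset edges G :\: edges (induced G U)) :
  let G1 := induced G (U :|: S1) in
  let G2 := induced G (U :|: S2) in
  let W1 := W :&: edges G1 in
  let W2 := W :&: edges G2 in
  (tau G W)%:R =
    (tau G1 W1)%:R * (tau G2 W2)%:R / (#|U|%:R ^ (#|U|%:Z - 2)) :> rat.
Proof.
move=> G1 G2 W1 W2.
have sUG: U \subset verts G by case/andP: U_clique.
have DV : verts G = U :|: S1 :|: S2.
  by rewrite -setUA S12_cover -{1}(setID (verts G) U) (setIidPr sUG).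
have DV1 : verts G1 = U :|: S1 by rewrite /= DV setIC; apply/setIidPl/subsetUl.
have DV2 : verts G2 = U :|: S2.
  by rewrite /= DV setIC; apply/setIidPl; rewrite setUAC subsetUl.
set K := edges (induced G U) in W_sub *.
pose N := closed_nbhd G S1.
have disN : [disjoint closed_nbhd G S2 & N] by rewrite -setI_eq0 setIC S12_nbhd.
set E0 := edges G :\: K in W_sub *.
pose E1 := edges G1 :\: K; pose E2 := edges G2 :\: K.
have := tau_clique U_nonempty U_clique W_sub; rewrite -/K -/E0 => tau0.
have sWE A : W :&: A \subset A :\: K.
  apply/subsetP=> e /setIP[We Ae]; rewrite in_setD Ae andbT.
  by have /setDP[] := subsetP W_sub e We.
have tau1 : #|U|%:R ^+ 2 * (tau G1 W1)%:R =
    \sum_(H : {set E} | [&& H \subset E1, forest (ends G) H & W1 \subset H])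
      forest_weight (ends G) U (U :|: S1) H :> rat.
  rewrite -DV1 /E1 /K -(edges_induced_induced G (subsetUl U S1)).
  apply: (tau_clique U_nonempty (clique_induced (subsetUl U S1) U_clique)).
  by rewrite edges_induced_induced ?subsetUl //; apply: sWE.
have tau2 : #|U|%:R ^+ 2 * (tau G2 W2)%:R =
    \sum_(H : {set E} | [&& H \subset E2, forest (ends G) H & W2 \subset H])
      forest_weight (ends G) U (U :|: S2) H :> rat.
  rewrite -DV2 /E2 /K -(edges_induced_induced G (subsetUl U S2)).
  apply: (tau_clique U_nonempty (clique_induced (subsetUl U S2) U_clique)).
  by rewrite edges_induced_induced ?subsetUl //; apply: sWE.
have E1N e : e \in E1 -> ends G e \subset N by apply: outer_edge_nbhd.
have E2N e : e \in E2 -> [disjoint ends G e & N].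
  by move/outer_edge_nbhd/disjointWl; apply.
have DE0 : E0 = E1 :|: E2.
  rewrite /E0 /E1 /E2 -setDUl; apply/setP=> e; rewrite !in_setD.
  have [// | K'e] /= := boolP (e \in K).
  apply/idP/idP=> [Ge | ]; last by rewrite !inE -andb_orr => /andP[].
  move: K'e; rewrite inE Ge => /subsetPn[x ex U'x].
  have := subsetP (ends_verts Ge) x ex.
  rewrite DV !in_setU (negPf U'x) => /orP[S1x | S2x]; apply/orP; [left | right].
    by apply: edge_induced_side DV _ Ge ex S1x; rewrite disjoint_sym.
  by apply: edge_induced_side disN Ge ex S2x; rewrite setUAC.
have disE : [disjoint E1 & E2].
  apply/pred0P=> e; apply/andP=> -[E1e /E2N disNe].
  have /setIidPl eN := E1N e E1e.
  have : e \in edges G by case/setDP: E1e; rewrite inE => /andP[].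
  by move/ends_card2; rewrite -eN (disjoint_setI0 disNe) cards0.
have glue : #|U|%:R ^+ 2 * (tau G1 W1)%:R * (#|U|%:R ^+ 2 * (tau G2 W2)%:R)
    = #|U|%:R ^+ #|U| * (#|U|%:R ^+ 2 * (tau G W)%:R) :> rat.
  rewrite tau0 tau1 tau2 big_distrlr pair_big mulr_sumr /=.
  (* H corresponds to the pair of its parts on the two sides. *)
  rewrite [RHS](reindex_onto (fun p => p.1 :|: p.2) (fun H => (H :&: E1, H :&: E2))) /=.
    apply: eq_big => [[H1 H2] | [H1 H2]] /=; last first.
      case/andP=> /and3P[/subsetP sH1 _ _] /and3P[/subsetP sH2 _ _].
      rewrite DV; apply: (@forest_weight_glue _ _ _ _ _ _ N).
      - exact: subsetUl.
      - exact: disjointWl (subsetUl _ _) disN.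
      - by move=> e /sH1/E1N.
      by move=> e /sH2/E2N.
    apply/andP/andP=> [[/and3P[sH1 f1 W1H] /and3P[sH2 f2 W2H]] | ].
      split; last first.
        rewrite !setIUl (setIidPl sH1) (setIidPl sH2).
        have /disjoint_setI0-> : [disjoint H1 & E2].
          exact: disjointWl sH1 disE.
        have /disjoint_setI0-> : [disjoint H2 & E1].
          by apply: disjointWl sH2 _; rewrite disjoint_sym.
        by rewrite set0U setU0.
      apply/and3P; split.
      - by rewrite DE0 setUSS.
      - apply: (@forestU_disjoint _ _ _ _ _ N) f1 f2 => e.
          by move/(subsetP sH1)/E1N.
        by move/(subsetP sH2)/E2N.
      - apply: subset_trans (setUSS W1H W2H).
        rewrite -setIUr; apply/subsetP=> e We; rewrite in_setI We.
        have := subsetP W_sub e We; rewrite DE0 !in_setU !in_setD.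
        by rewrite -andb_orr => /andP[].
    case=> /and3P[sH fH WH] /eqP[DH1 DH2].
    have WiH A : W :&: A \subset (H1 :|: H2) :&: (A :\: K).
      by rewrite subsetI sWE subIset ?WH.
    split; apply/and3P; split.
    - by rewrite -DH1 subsetIr.
    - exact: forestS (subsetUl H1 H2) fH.
    - by rewrite -DH1; apply: WiH.
    - by rewrite -DH2 subsetIr.
    - exact: forestS (subsetUr H1 H2) fH.
    by rewrite -DH2; apply: WiH.
  move=> H /and3P[sH _ _]; rewrite -setIUr -DE0.
  exact/setIidPl.
have u_neq0 : #|U|%:R != 0 :> rat by rewrite pnatr_eq0 cards_eq0.
rewrite expfzDr // -exprnP -exprnN.
have cancel (F : fieldType) (a b t t1 t2 : F) : a != 0 -> b != 0 ->
    a * t1 * (a * t2) = b * (a * t) -> t = t1 * t2 / (b * a^-1).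
  move=> a0 b0 eq_t; apply: (mulfI (mulf_neq0 b0 a0)); rewrite -mulrA -eq_t.
  by field; rewrite a0 b0.
by apply: cancel glue; rewrite expf_neq0.
Qed.
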